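(* Let $H_1$ and $H_2$ be graphs (not necessarily connected) with disjoint vertex sets, having $n_1\geq 1$ and $n_2\geq 1$ vertices respectively. Let $G=H_1\vee H_2$ be their join, and let $n=n_1+n_2$. Then $\mathcal{K}(G)\leq 3n$.
   Context: Graphs are finite, simple, undirected and unweighted. The join $H_1\vee H_2$ is the graph obtained from the disjoint union of $H_1$ and $H_2$ by adding all edges joining a vertex of $H_1$ to a vertex of $H_2$. For a connected graph $G$ with vertex set $\{1,\dots,n\}$, $m$ edges and vertex degrees $d_1,\dots,d_n$, Kemeny's constant is $\mathcal{K}(G)=\sum_{j\neq i}\frac{d_j}{2m}\,m_{i,j}$, where $m_{i,j}$ is the expected first time at which the simple random walk on $G$ (which moves at each step to a uniformly random neighbour) started at $i$ reaches $j$; this value does not depend on the choice of $i$. *)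

(* Defs.v *)
From HB Require Import structures.
From mathcomp Require Import all_boot all_order all_algebra.
From mathcomp Require Import all_classical all_reals all_analysis.
Set Implicit Arguments.
Unset Strict Implicit.
Unset Printing Implicit Defensive.
Import Order.TTheory GRing.Theory Num.Theory.
Local Open Scope ring_scope.

Record sgraph := SGraph {
  vertex :> finType;
  adj : rel vertex;
  adj_sym : symmetric adj;
  adj_irr : irreflexive adj }.

(* The sum type makes the two vertex sets disjoint. *)
Definition join_rel (H1 H2 : sgraph) : rel (H1 + H2)%type :=
  fun u v => match u, v with
  | inl x, inl y => adj x y
  | inr x, inr y => adj x y
  | _, _ => true
  end.

Lemma join_sym (H1 H2 : sgraph) : symmetric (@join_rel H1 H2).
Proof. by case=> x [] y //=; apply: adj_sym. Qed.

Lemma join_irr (H1 H2 : sgraph) : irreflexive (@join_rel H1 H2).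
Proof. by case=> x /=; apply: adj_irr. Qed.

Definition join (H1 H2 : sgraph) : sgraph :=
  SGraph (@join_sym H1 H2) (@join_irr H1 H2).

Section Kemeny.
Variables (R : realType) (G : sgraph).
Implicit Types (x i j : G) (w : seq G) (k : nat).

Definition deg x : nat := #|[set y : G | adj x y]|.

Definition edges : {set {set G}} :=
  [set e | [exists x, exists y, adj x y && (e == [set x; y])]].

Definition step_prob x y : R := if adj x y then (deg x)%:R^-1 else 0.

(* Probability that the walk started at x makes its first [size w] steps
   through the successive vertices of w. *)
Fixpoint traj_prob x w : R :=
  if w is y :: w' then step_prob x y * traj_prob y w' else 1.

(* P(T = k), where T is the first time t >= 0 at which the walk
   X_0 = i, X_1, X_2, ... is at j: the sum runs over the trajectories
   (X_1, ..., X_k) = w such that X_k = j and X_0, ..., X_(k-1) avoid j. *)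
Definition hit_prob i j k : R :=
  \sum_(w : k.-tuple G | (last i w == j) && (j \notin belast i w))
     traj_prob i w.

(* E[T]; the second summand is the contribution of the event T = +oo, which
   vanishes when that event has probability 0 since +oo * 0 = 0. *)
Definition mean_hit i j : \bar R :=
  (\sum_(0 <= k <oo) (k%:R * hit_prob i j k)%:E
   + +oo * (1 - \sum_(0 <= k <oo) (hit_prob i j k)%:E))%E.

(* Kemeny's constant computed from the starting vertex i; for connected G the
   value is the same for every i. *)
Definition kemeny i : \bar R :=
  (\sum_(j | j != i)
     ((deg j)%:R / (2 * #|edges|)%:R)%:E * mean_hit i j)%E.

End Kemeny.

(* Main.v *)
From HB Require Import structures.
Require Import Defs.
From mathcomp Require Import all_boot all_order all_algebra.
From mathcomp Require Import ring lra.
From mathcomp Require Import all_classical all_reals all_analysis.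
Import Order.TTheory GRing.Theory Num.Theory.
Local Open Scope ring_scope.

(** In electrical terms Kemeny's constant is the sum over the vertices j of
deg j times the effective resistance between j and a distribution rho on the
vertices, up to a nonpositive correction; rho can be chosen freely.  In a join,
with rho uniform on one side, that resistance is at most 2 / deg j, so the
constant is at most 2n, hence at most 3n.

The resistance enters through its dual description.  Fix weights rho of
total mass 1 on the vertices and suppose that every function phi satisfies
(phi j - rho.phi)^2 <= C j * energy phi, where rho.phi is the rho-mean and
energy is the Dirichlet energy.  [kemeny_le] deduces that Kemeny's constant
is at most the sum of deg j * C j, whatever the starting vertex:
the Poincare inequality makes the Laplacian invertible modulo constants
([green_exists]), so there are potentials g j with Laplacian e_j - rho and
rho-mean 0.  Applied to phi = g j, the inequality gives g j j <= C j.
With d the degree vector and vol its sum, and s the degree-weighted sum of the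
g k, the function
  h j x = s x - vol * g j x + (vol * g j j - s j)
vanishes at j and has Laplacian d - vol * e_j; these are the equations of the
expected hitting times of j, and [mean_hit_le] bounds the hitting times by any
nonnegative solution.  In the stationary average of h j i over j the terms
that depend on i cancel, leaving the sum of deg j * g j j minus
energy s / vol.

For the join, rho is uniform on the second graph.  Subtracting from phi its mean
there makes the cross terms in the energy of the joining edges vanish, and that
energy becomes a sum of squares over the vertices ([join_cross_energy]).  These
squares and the edges at a vertex v inside its own side control
deg v * (phi v - mean)^2 with constant 2 ([join_poincare]). *)

(** * Degrees and edges *)

Lemma deg_sum1 (G : sgraph) (x : G) : deg x = (\sum_(y | adj x y) 1)%N.
Proof. by rewrite sum1_card; apply: eq_card => y; rewrite !inE. Qed.

Lemma sum_adj_const (R : realType) (G : sgraph) (x : G) (c : R) :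
  \sum_(y | adj x y) c = (deg x)%:R * c.
Proof.
by rewrite sumr_const mulr_natl; congr (_ *+ _); apply: eq_card => y; rewrite !inE.
Qed.

Lemma sum_adj_sym (R : realType) (G : sgraph) (F : G -> G -> R) :
  \sum_x \sum_(y | adj x y) F x y = \sum_x \sum_(y | adj x y) F y x.
Proof.
rewrite (exchange_big_dep predT) //=; apply: eq_bigr => y _.
by apply: eq_bigl => x; rewrite adj_sym.
Qed.

(** Each edge is counted at both of its endpoints: the ordered pairs of adjacent
vertices are grouped by the edge that they span. *)
Lemma handshake (G : sgraph) : (\sum_(x : G) deg x = 2 * #|edges G|)%N.
Proof.
under eq_bigr => x _ do rewrite deg_sum1.
rewrite pair_big_dep /=.
rewrite (partition_big (fun p : G * G => [set p.1; p.2]) (mem (edges G))) /=;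
  last first.
  move=> [x y] /= xy; rewrite inE; apply/existsP; exists x.
  by apply/existsP; exists y; rewrite xy eqxx.
rewrite mulnC -sum_nat_const; apply: eq_bigr => e.
rewrite inE => /existsP[x /existsP[y /andP[xy /eqP ->]]].
have nxy : x != y by apply: contraTneq xy => ->; rewrite adj_irr.
have <- : #|[set (x, y); (y, x)]| = 2%N by rewrite cards2 xpair_eqE negb_and nxy.
rewrite sum1_card; apply: eq_card => -[a b].
rewrite !inE unfold_in /= !xpair_eqE.
apply/idP/idP => [/andP[ab /eqP/setP E]|].
  have nab : a != b by apply: contraTneq ab => ->; rewrite adj_irr.
  have := E a; have := E b; rewrite !inE !eqxx ?orbT /=.
  move=> /esym/orP[/eqP bx|/eqP bY] /esym/orP[/eqP ax|/eqP aY]; subst;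
    rewrite ?eqxx ?orbT //; by rewrite eqxx in nab.
case/orP=> /andP[/eqP -> /eqP ->]; first by rewrite xy eqxx.
by rewrite adj_sym xy finset.setUC eqxx.
Qed.

(** * Laplacian and Dirichlet energy *)

Definition lap {R : realType} {G : sgraph} (phi : G -> R) (x : G) : R :=
  \sum_(y | adj x y) (phi x - phi y).

(** The double sum sees every edge in both directions, whence the factor 1/2. *)
Definition energy {R : realType} {G : sgraph} (phi : G -> R) : R :=
  2^-1 * \sum_x \sum_(y | adj x y) (phi x - phi y) ^+ 2.

Lemma energy_ge0 (R : realType) (G : sgraph) (phi : G -> R) : 0 <= energy phi.
Proof.
rewrite mulr_ge0 ?invr_ge0 //; apply: sumr_ge0 => x _.
by apply: sumr_ge0 => y _; rewrite sqr_ge0.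
Qed.

Lemma lapE (R : realType) (G : sgraph) (phi : G -> R) x :
  lap phi x = (deg x)%:R * phi x - \sum_(y | adj x y) phi y.
Proof. by rewrite /lap sumrB sum_adj_const. Qed.

Lemma sum_lap (R : realType) (G : sgraph) (phi : G -> R) :
  \sum_x lap phi x = 0.
Proof.
have h := sum_adj_sym R G (fun x y => phi x - phi y).
have : \sum_x lap phi x = - \sum_x lap phi x.
  rewrite [LHS]h -sumrN; apply: eq_bigr => x _; rewrite -sumrN.
  by apply: eq_bigr => y _; rewrite opprB.
by move=> e; lra.
Qed.

(** Summation by parts. *)
Lemma green_identity (R : realType) (G : sgraph) (phi : G -> R) :
  \sum_x phi x * lap phi x = energy phi.
Proof.
rewrite /energy.
have -> : \sum_x \sum_(y | adj x y) (phi x - phi y) ^+ 2 =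
  \sum_x phi x * lap phi x + \sum_x phi x * lap phi x.
  have {2}-> : \sum_x phi x * lap phi x =
    \sum_x \sum_(y | adj x y) phi y * (phi y - phi x).
    rewrite -(sum_adj_sym R G (fun x y => phi x * (phi x - phi y))).
    by apply: eq_bigr => x _; rewrite mulr_sumr.
  rewrite -big_split /=; apply: eq_bigr => x _.
  rewrite mulr_sumr -big_split /=; apply: eq_bigr => y _; ring.
by lra.
Qed.

Lemma lap_linear (R : realType) (G : sgraph) (a : R) (f g : G -> R) x :
  lap (fun y => a * f y + g y) x = a * lap f x + lap g x.
Proof.
rewrite /lap mulr_sumr -big_split /=; apply: eq_bigr => y _; ring.
Qed.

Lemma lap_sum (R : realType) (G : sgraph) (I : finType) (a : I -> R)
    (f : I -> G -> R) x :
  lap (fun y => \sum_k a k * f k y) x = \sum_k a k * lap (f k) x.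
Proof.
rewrite /lap; under [RHS]eq_bigr => k _ do rewrite mulr_sumr.
rewrite [RHS]exchange_big /=; apply: eq_bigr => y _.
by rewrite -sumrB; apply: eq_bigr => k _; rewrite mulrBr.
Qed.

(** The potential of a unit current entering at j and leaving along rho.  The
Laplacian kills the constants and its values always sum to 0; adding to it the
rank-one map phi |-> (rho.phi) rho makes up for this defect.  The values of
T phi = lap phi + (rho.phi) rho sum to rho.phi, so T phi = 0 forces rho.phi = 0 and
lap phi = 0, hence phi = 0.  The preimage of e_j under the bijection T has rho-mean
1, and subtracting the constant 1 from it gives g. *)
Lemma green_exists (R : realType) (G : sgraph) (rho : G -> R)
    (rho1 : \sum_x rho x = 1)
    (energy0_const : forall phi : G -> R, energy phi = 0 ->
       forall x, phi x = \sum_y rho y * phi y) (j : G) :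
  exists g : G -> R, (forall x, lap g x = (x == j)%:R - rho x) /\
    \sum_x rho x * g x = 0.
Proof.
pose V := {ffun G -> R^o}.
pose T (f : V) : V := [ffun x => lap f x + rho x * \sum_y rho y * f y].
have Tlin : linear T.
  move=> a f g; apply/ffunP => x; rewrite !ffunE.
  have -> : lap (a *: f + g : V) x = lap (fun y => a * f y + g y) x.
    by apply: eq_bigr => y _; rewrite !ffunE.
  rewrite lap_linear.
  have -> : \sum_y rho y * (a *: f + g : V) y =
     a * (\sum_y rho y * f y) + \sum_y rho y * g y.
    rewrite mulr_sumr -big_split /=; apply: eq_bigr => y _.
    by rewrite !ffunE /GRing.scale /=; ring.
  by rewrite /GRing.scale /=; ring.
pose Tl := GRing.isLinear.Build R V V *:%R T Tlin.
pose L : {linear V -> V} := HB.pack T Tl.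
have sumT f : \sum_x T f x = \sum_y rho y * f y.
  under eq_bigr => x _ do rewrite ffunE.
  by rewrite big_split /= sum_lap add0r -mulr_suml rho1 mul1r.
have kerL : lker (linfun L) == 0%VS.
  apply/lker0P => f g; rewrite !lfunE /= => Tfg.
  apply/eqP; rewrite -subr_eq0; apply/eqP.
  set u := f - g.
  have Tu : T u = 0 by rewrite -[T]/(L : V -> V) raddfB /= Tfg subrr.
  have ru : \sum_y rho y * u y = 0.
    by rewrite -sumT Tu big1 // => x _; rewrite ffunE.
  have lu x : lap u x = 0.
    by move/ffunP/(_ x): Tu; rewrite !ffunE ru mulr0 addr0.
  apply/ffunP => x; rewrite [RHS]ffunE -[RHS]ru; apply: energy0_const.
  by rewrite -green_identity big1 // => z _; rewrite lu mulr0.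
pose e : V := [ffun x => (x == j)%:R].
pose u : V := ((linfun L)^-1)%VF e.
have Tu : T u = e by have := lker0_lfunVK kerL e; rewrite lfunE.
have ru : \sum_y rho y * u y = 1.
  rewrite -sumT Tu (bigD1 j) //= ffunE eqxx big1 ?addr0 // => x xj.
  by rewrite ffunE (negbTE xj).
exists (fun x => u x - 1); split => [x|].
  have -> : lap (fun y => u y - 1) x = lap u x.
    by apply: eq_bigr => y _; ring.
  have /ffunP/(_ x) := Tu; rewrite !ffunE ru mulr1 => <-; ring.
under eq_bigr => x _ do rewrite mulrBr mulr1.
by rewrite sumrB ru rho1 subrr.
Qed.

(** Minimum principle: at a minimum the Laplacian is nonpositive. *)
Lemma lap_gt0_ge0 (R : realType) (G : sgraph) (h : G -> R) (j : G)
    (hj : 0 <= h j) (hL : forall x, x != j -> 0 < lap h x) x : 0 <= h x.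
Proof.
case: (@arg_minP _ R _ j predT h isT) => m _ hm.
apply: le_trans (hm x isT).
have [->//|mj] := eqVneq m j.
have := hL _ mj; rewrite ltNge => /negP[].
by apply: sumr_le0 => y _; rewrite subr_le0 hm.
Qed.

(** * Hitting times *)

Lemma sum_tupleS (R : realType) (T : finType) k (F : seq T -> R) :
  \sum_(w : k.+1.-tuple T) F w = \sum_y \sum_(w : k.-tuple T) F (y :: w).
Proof.
rewrite pair_big /=.
rewrite (reindex (fun p : T * k.-tuple T => [tuple of p.1 :: p.2])) //=.
exists (fun w : k.+1.-tuple T => (thead w, [tuple of behead w])).
  by move=> [y w] _ /=; rewrite theadE; congr (_, _); apply: val_inj.
by move=> w _ /=; rewrite -tuple_eta.
Qed.

Lemma hit_prob0 (R : realType) (G : sgraph) (x j : G) :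
  hit_prob R x j 0 = (x == j)%:R.
Proof.
rewrite /hit_prob big_mkcond (big_pred1 [tuple]) /=; last first.
  by move=> w; rewrite [w]tuple0 /= eqxx.
by rewrite andbT; case: eqP.
Qed.

(** First-step analysis. *)
Lemma hit_probS (R : realType) (G : sgraph) (x j : G) k :
  hit_prob R x j k.+1 =
    if x == j then 0 else \sum_y step_prob R x y * hit_prob R y j k.
Proof.
rewrite /hit_prob big_mkcond /=.
rewrite (sum_tupleS R G k (fun w =>
  if (last x w == j) && (j \notin belast x w) then traj_prob R x w else 0)).
case: (eqVneq x j) => [->|xj].
  rewrite big1 // => y _; rewrite big1 // => w _ /=.
  by rewrite inE eqxx andbF.
apply: eq_bigr => y _; rewrite mulr_sumr [RHS]big_mkcond /=.
apply: eq_bigr => w _.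
by rewrite inE negb_or [j == x]eq_sym xj.
Qed.

Lemma sum_step (R : realType) (G : sgraph) (x : G) (F : G -> R) :
  \sum_y step_prob R x y * F y = (deg x)%:R^-1 * \sum_(y | adj x y) F y.
Proof.
rewrite mulr_sumr [RHS]big_mkcond /=; apply: eq_bigr => y _.
by rewrite /step_prob; case: ifP => // _; rewrite mul0r.
Qed.

Lemma step_prob_ge0 (R : realType) (G : sgraph) (x y : G) :
  0 <= step_prob R x y.
Proof. by rewrite /step_prob; case: ifP => // _; rewrite invr_ge0. Qed.

Lemma step_prob_sum1 (R : realType) (G : sgraph) (x : G) :
  (0 < deg x)%N -> \sum_y step_prob R x y = 1.
Proof.
move=> d0; under eq_bigr => y _ do rewrite -[step_prob _ _ _]mulr1.
by rewrite sum_step sum_adj_const mulr1 mulVf // pnatr_eq0 -lt0n.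
Qed.

Lemma hit_prob_ge0 (R : realType) (G : sgraph) (x j : G) k :
  0 <= hit_prob R x j k.
Proof.
elim: k x => [|k IH] x; first by rewrite hit_prob0 ler0n.
rewrite hit_probS; case: ifP => // _; apply: sumr_ge0 => y _.
by rewrite mulr_ge0 ?step_prob_ge0.
Qed.

Lemma hit_at_target (R : realType) (G : sgraph) (j : G) N :
  \sum_(0 <= k < N.+1) hit_prob R j j k = 1.
Proof.
rewrite big_nat_recl // hit_prob0 eqxx big1 ?addr0 // => k _.
by rewrite hit_probS eqxx.
Qed.

Lemma hit_le1 (R : realType) (G : sgraph) (j : G)
    (deg_gt0 : forall x : G, (0 < deg x)%N) N x :
  \sum_(0 <= k < N) hit_prob R x j k <= 1.
Proof.
elim: N x => [|N IH] x; first by rewrite big_geq.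
have [->|xj] := eqVneq x j; first by rewrite hit_at_target.
rewrite big_nat_recl // hit_prob0 (negbTE xj) add0r.
under eq_bigr => k _ do rewrite hit_probS (negbTE xj).
rewrite exchange_big /= -[leRHS](step_prob_sum1 R G x) //.
by apply: ler_sum => y _; rewrite -mulr_sumr ler_piMr ?step_prob_ge0.
Qed.

(** E[min(T, N)] for the hitting time T of j from x: the second summand is the
contribution of the event T >= N. *)
Definition trunc_hit {R : realType} {G : sgraph} (j : G) (N : nat) (x : G) : R :=
  \sum_(0 <= k < N) k%:R * hit_prob R x j k
  + N%:R * (1 - \sum_(0 <= k < N) hit_prob R x j k).

(** For x other than j, E_x[min(T, N + 1)] is 1 plus the mean of E_y[min(T, N)] over
the neighbours y of x, so the truncated expectation stays below h by induction
on N. *)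
Lemma trunc_hit_le (R : realType) (G : sgraph) (j : G)
    (deg_gt0 : forall x : G, (0 < deg x)%N) (h : G -> R) (h0 : forall x, 0 <= h x)
    (hS : forall x, x != j -> 1 + \sum_y step_prob R x y * h y <= h x) N x :
  trunc_hit j N x <= h x.
Proof.
elim: N x => [|N IH] x; first by rewrite /trunc_hit big_geq // mul0r addr0.
have [->|xj] := eqVneq x j.
  rewrite /trunc_hit hit_at_target subrr mulr0 addr0.
  rewrite big_nat_recl // mul0r add0r big1 // => k _.
  by rewrite hit_probS eqxx mulr0.
apply: le_trans (hS _ xj).
have -> : trunc_hit j N.+1 x = 1 + \sum_y step_prob R x y * trunc_hit j N y.
  rewrite /trunc_hit !big_nat_recl // hit_prob0 (negbTE xj) mul0r !add0r.
  pose K y := \sum_(0 <= k < N) k%:R * hit_prob R y j k.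
  pose F y := \sum_(0 <= k < N) hit_prob R y j k.
  have -> : \sum_(0 <= k < N) k.+1%:R * hit_prob R x j k.+1 =
      \sum_y step_prob R x y * (K y + F y).
    under eq_bigr => k _ do rewrite hit_probS (negbTE xj) mulr_sumr.
    rewrite exchange_big; apply: eq_bigr => y _.
    rewrite -big_split mulr_sumr /=; apply: eq_bigr => k _.
    by rewrite -natr1; ring.
  have -> : \sum_(0 <= k < N) hit_prob R x j k.+1 =
      \sum_y step_prob R x y * F y.
    under eq_bigr => k _ do rewrite hit_probS (negbTE xj).
    by rewrite exchange_big; apply: eq_bigr => y _; rewrite mulr_sumr.
  have -> : \sum_y step_prob R x y * (K y + N%:R * (1 - F y)) =
      \sum_y step_prob R x y * (K y + F y)
      + N%:R * \sum_y step_prob R x y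
      - N.+1%:R * \sum_y step_prob R x y * F y.
    rewrite !mulr_sumr -big_split -sumrB /=; apply: eq_bigr => y _.
    by rewrite -natr1; ring.
  by rewrite step_prob_sum1 // -natr1; ring.
rewrite lerD2l; apply: ler_sum => y _.
by rewrite ler_wpM2l ?step_prob_ge0.
Qed.

(** Truncation at N shows both that N * P(T >= N) <= h x, so that T is almost
surely finite and the +oo term of the mean vanishes, and that the partial sums of
the expectation are at most h x. *)
Lemma mean_hit_le (R : realType) (G : sgraph) (j : G)
    (deg_gt0 : forall x : G, (0 < deg x)%N) (h : G -> R) (h0 : forall x, 0 <= h x)
    (hS : forall x, x != j -> 1 + \sum_y step_prob R x y * h y <= h x) x :
  (mean_hit R x j <= (h x)%:E)%E.
Proof.
have T N := trunc_hit_le R G j deg_gt0 h h0 hS N x.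
have hit1 N := hit_le1 R G j deg_gt0 N x.
have kn N : 0 <= \sum_(0 <= k < N) k%:R * hit_prob R x j k.
  by apply: sumr_ge0 => k _; rewrite mulr_ge0 ?hit_prob_ge0.
have e0 k : (0 <= (hit_prob R x j k)%:E)%E by rewrite lee_fin hit_prob_ge0.
have S1 : (\sum_(0 <= k <oo) (hit_prob R x j k)%:E = 1)%E.
  have le1 : (\sum_(0 <= k <oo) (hit_prob R x j k)%:E <= 1)%E.
    apply: lime_le; first exact: is_cvg_nneseries.
    by apply: nearW => N; rewrite sumEFin lee_fin.
  have ge0 : (0 <= \sum_(0 <= k <oo) (hit_prob R x j k)%:E)%E.
    exact: nneseries_ge0.
  have geN N : ((\sum_(0 <= k < N) hit_prob R x j k)%:E <=
      \sum_(0 <= k <oo) (hit_prob R x j k)%:E)%E.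
    by rewrite -sumEFin; apply: nneseries_lim_ge.
  case: (limn _) le1 ge0 geN => [s| |] //; rewrite !lee_fin => s1 s0 geN.
  congr EFin; apply/eqP; rewrite eq_le s1 /= leNgt; apply/negP => slt.
  have d0 : 0 < 1 - s by rewrite subr_gt0.
  (* Were s < 1, some N would have N * (1 - s) > h x. *)
  have := archi_boundP (divr_ge0 (h0 x) (ltW d0)).
  set N := Num.bound _; rewrite ltr_pdivrMr // => hlt.
  have := T N; rewrite /trunc_hit leNgt => /negP; apply.
  apply: lt_le_trans hlt _; rewrite -[leLHS]add0r lerD ?kn //.
  rewrite ler_wpM2l // lerB //.
  by have := geN N; rewrite lee_fin.
rewrite /mean_hit S1 subee // mule0 adde0.
apply: lime_le.
  by apply: is_cvg_nneseries => k _ _; rewrite lee_fin mulr_ge0 ?hit_prob_ge0.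
apply: nearW => N; rewrite sumEFin lee_fin.
by apply: le_trans (T N); rewrite /trunc_hit lerDl mulr_ge0 // subr_ge0.
Qed.

(** * Kemeny's constant from a Poincare inequality *)

(** The terms g j i cancel in the stationary average of the hitting times because
they occur once through s i and once through the weighted sum of the g j i.  What
remains besides the diagonal is -(d.s) / vol, and d.s = energy s is nonnegative
since s has rho-mean 0. *)
Lemma kemeny_le (R : realType) (G : sgraph) (rho C : G -> R)
    (deg_gt0 : forall x : G, (0 < deg x)%N) (rho1 : \sum_x rho x = 1)
    (C_ge0 : forall x, 0 <= C x)
    (poincare : forall (phi : G -> R) x,
       (phi x - \sum_y rho y * phi y) ^+ 2 <= C x * energy phi) (i : G) :
  (kemeny R i <= (\sum_x (deg x)%:R * C x)%:E)%E.
Proof.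
have energy0_const (phi : G -> R) : energy phi = 0 ->
    forall x, phi x = \sum_y rho y * phi y.
  move=> E0 x; have := poincare phi x; rewrite E0 mulr0 => le0.
  by apply/eqP; rewrite -subr_eq0 -sqrf_eq0 eq_le le0 sqr_ge0.
have [g gP] := choice (green_exists R G rho rho1 energy0_const).
have gL j x : lap (g j) x = (x == j)%:R - rho x by case: (gP j).
have g0 j : \sum_x rho x * g j x = 0 by case: (gP j).
have sum_delta (F : G -> R) j : \sum_x F x * (x == j)%:R = F j.
  rewrite (bigD1 j) //= eqxx mulr1 big1 ?addr0 // => x xj.
  by rewrite (negbTE xj) mulr0.
pose vol : R := \sum_(x : G) (deg x)%:R.
have vol_gt0 : 0 < vol.
  rewrite /vol (bigD1 i) //= ltr_pwDl ?ltr0n //.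
  by apply: sumr_ge0 => x _; rewrite ler0n.
(* The diagonal value g j j is the energy of g j, that is, the effective resistance
   between j and rho. *)
have gC j : g j j <= C j.
  have E : energy (g j) = g j j.
    rewrite -green_identity.
    under eq_bigr => x _ do rewrite gL mulrBr [g j x * rho x]mulrC.
    by rewrite sumrB g0 subr0 sum_delta.
  have := poincare (g j) j; rewrite g0 subr0 E expr2.
  have : 0 <= g j j by rewrite -E energy_ge0.
  rewrite le_eqVlt => /orP[/eqP <- //|gj0].
  by rewrite ler_pM2r.
pose s x := \sum_k (deg k)%:R * g k x.
have sL x : lap s x = (deg x)%:R - vol * rho x.
  rewrite lap_sum; under eq_bigr => k _ do rewrite gL mulrBr.
  rewrite sumrB -mulr_suml; congr (_ - _).
  rewrite -(sum_delta (fun k => (deg k)%:R) x).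
  by apply: eq_bigr => k _; rewrite eq_sym.
have s0 : \sum_x rho x * s x = 0.
  under eq_bigr => x _ do rewrite mulr_sumr.
  rewrite exchange_big big1 //= => k _.
  under eq_bigr => x _ do rewrite mulrCA.
  by rewrite -mulr_sumr g0 mulr0.
have ds : 0 <= \sum_x (deg x)%:R * s x.
  apply: le_trans (energy_ge0 R G s) _; rewrite -green_identity.
  under eq_bigr => x _ do
    rewrite sL mulrBr mulrCA [s x * rho x]mulrC [s x * _]mulrC.
  by rewrite sumrB -mulr_sumr s0 mulr0 subr0.
pose h j x := s x - vol * g j x + (vol * g j j - s j).
have hjj j : h j j = 0 by rewrite /h; ring.
have hL j x : lap (h j) x = (deg x)%:R - vol * (x == j)%:R.
  have -> : lap (h j) x = lap (fun y => - vol * g j y + s y) x.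
    by apply: eq_bigr => y _; rewrite /h; ring.
  by rewrite lap_linear gL sL; ring.
have h0 j x : 0 <= h j x.
  apply: (lap_gt0_ge0 R G _ j); first by rewrite hjj.
  by move=> y yj; rewrite hL (negbTE yj) mulr0 subr0 ltr0n.
have hS j x : x != j -> 1 + \sum_y step_prob R x y * h j y <= h j x.
  move=> xj; rewrite sum_step.
  have := hL j x; rewrite lapE (negbTE xj) mulr0 subr0 => e.
  have d0 : (deg x)%:R != 0 :> R by rewrite pnatr_eq0 -lt0n.
  have -> : \sum_(y | adj x y) h j y = (deg x)%:R * h j x - (deg x)%:R by lra.
  by rewrite mulrBr mulKf // mulVf // addrC subrK.
have volE : (2 * #|edges G|)%:R = vol by rewrite -handshake natr_sum.
apply: (@le_trans _ _ (\sum_(j | j != i) ((deg j)%:R / vol * h j i)%:E)%E).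
  rewrite /kemeny volE; apply: lee_sum => j _; rewrite [leRHS]EFinM.
  apply: lee_wpmul2l; first by rewrite lee_fin divr_ge0 // ltW.
  exact: (mean_hit_le R G j deg_gt0 (h j) (h0 j) (hS j)).
rewrite sumEFin lee_fin.
apply: (@le_trans _ _ (\sum_j (deg j)%:R / vol * h j i)).
  by rewrite [leRHS](bigD1 i) //= lerDr hjj mulr0.
have -> : \sum_j (deg j)%:R / vol * h j i =
   \sum_j (deg j)%:R * g j j - vol^-1 * \sum_x (deg x)%:R * s x.
  have -> : \sum_j (deg j)%:R / vol * h j i =
    \sum_j ((deg j)%:R * (vol^-1 * s i) - (deg j)%:R * g j i
      + ((deg j)%:R * g j j - vol^-1 * ((deg j)%:R * s j))).
    by apply: eq_bigr => j _; rewrite /h; field; rewrite gt_eqF.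
  rewrite big_split !sumrB /= -mulr_suml -/vol -/(s i) mulVKf ?gt_eqF //.
  by rewrite subrr add0r mulr_sumr.
apply: (@le_trans _ _ (\sum_j (deg j)%:R * g j j)).
  by rewrite gerBl mulr_ge0 // invr_ge0 ltW.
by apply: ler_sum => j _; rewrite ler_wpM2l.
Qed.

(** * Energy in a join *)

(** Every edge at v appears twice in the double sum of the energy, in the row of v
and in the row of its other endpoint, which makes up for the factor 1/2. *)
Lemma star_energy_le (R : realType) (G : sgraph) (phi : G -> R) (v : G) :
  \sum_(w | adj v w) (phi v - phi w) ^+ 2 <= energy phi.
Proof.
set S := \sum_(w | adj v w) _.
have : S + S <= \sum_x \sum_(y | adj x y) (phi x - phi y) ^+ 2.
  rewrite [leRHS](bigD1 v) //=; apply: lerD; first by [].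
  rewrite {1}/S (bigID (pred1 v)) /= big1 => [|w /andP[vw /eqP wv]]; last first.
    by rewrite wv adj_irr in vw.
  rewrite add0r [leLHS]big_mkcondl /=; apply: ler_sum => x xv.
  case: ifP => vx; last by apply: sumr_ge0 => y _; rewrite sqr_ge0.
  rewrite (bigD1 v) /=; last by rewrite adj_sym.
  rewrite -[(phi v - _) ^+ 2]sqrrN opprB lerDl.
  by apply: sumr_ge0 => y _; rewrite sqr_ge0.
by rewrite /energy; lra.
Qed.

(** By chi v ^ 2 <= 2 (chi w ^ 2 + (chi v - chi w) ^ 2), each neighbour w of v
contributes at least half of chi v ^ 2, through the squares at w and along the
edge from v to w.  As c >= 1, the square at w has weight at least 1;
the square at v itself supplies the term c. *)
Lemma vertex_energy_bound (R : realType) (G : sgraph) (c : R) (chi : G -> R)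
    (v : G) (c1 : 1 <= c) :
  (c + (deg v)%:R) * chi v ^+ 2 <= 2 * (c * \sum_w chi w ^+ 2 + energy chi).
Proof.
have star := star_energy_le R G chi v.
have nv : \sum_(w | adj v w) chi w ^+ 2 + chi v ^+ 2 <= \sum_w chi w ^+ 2.
  rewrite [leRHS](bigD1 v) //= [leLHS]addrC lerD2l.
  rewrite [leRHS](bigID (fun w => adj v w)) /= -[leLHS]addr0 lerD //.
    rewrite le_eqVlt; apply/orP; left; apply/eqP; apply: eq_bigl => w.
    by case: (eqVneq w v) => [->|]; rewrite ?adj_irr ?andbT.
  by apply: sumr_ge0 => w _; rewrite sqr_ge0.
have half : (deg v)%:R * chi v ^+ 2 <=
    2 * (\sum_(w | adj v w) chi w ^+ 2 + \sum_(w | adj v w) (chi v - chi w) ^+ 2).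
  rewrite -sum_adj_const -big_split mulr_sumr /=; apply: ler_sum => w _.
  by have := sqr_ge0 (chi v - 2 * chi w); nra.
have nn : 0 <= \sum_(w | adj v w) chi w ^+ 2.
  by apply: sumr_ge0 => w _; rewrite sqr_ge0.
have := sqr_ge0 (chi v); nra.
Qed.

(** The cross term -2 (sum of a) (sum of b) vanishes as soon as one of the two
families has sum 0. *)
Lemma join_cross_energy (R : realType) (I J : finType) (a : I -> R) (b : J -> R)
    (b0 : \sum_w b w = 0) :
  \sum_z \sum_w (a z - b w) ^+ 2 =
  #|J|%:R * (\sum_z a z ^+ 2) + #|I|%:R * (\sum_w b w ^+ 2).
Proof.
have -> : #|I|%:R * (\sum_w b w ^+ 2) = \sum_(z : I) \sum_w b w ^+ 2.
  by rewrite sumr_const mulr_natl.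
rewrite mulr_sumr -big_split /=; apply: eq_bigr => z _.
have -> : #|J|%:R * a z ^+ 2 = \sum_(w : J) a z ^+ 2.
  by rewrite sumr_const mulr_natl.
have cross0 : \sum_w 2 * a z * b w = 0 by rewrite -mulr_sumr b0 mulr0.
rewrite -[LHS]addr0 -[X in _ + X]cross0 -!big_split /=.
by apply: eq_bigr => w _; ring.
Qed.

Lemma energy_join (R : realType) (H1 H2 : sgraph) (phi : join H1 H2 -> R) :
  energy phi = energy (fun x : H1 => phi (inl x)) + energy (fun y : H2 => phi (inr y))
    + \sum_(x : H1) \sum_(y : H2) (phi (inl x) - phi (inr y)) ^+ 2.
Proof.
rewrite /energy big_sumType /=.
under eq_bigr => x _ do rewrite big_sumType /=.
under [X in _ * (_ + X)]eq_bigr => x _ do rewrite big_sumType /=.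
rewrite !big_split /= [X in _ + (X + _)]exchange_big /=.
have -> : \sum_(x : H1) \sum_(y : H2) (phi (inr y) - phi (inl x)) ^+ 2 =
  \sum_(x : H1) \sum_(y : H2) (phi (inl x) - phi (inr y)) ^+ 2.
  by apply: eq_bigr => x _; apply: eq_bigr => y _; ring.
by lra.
Qed.

Lemma deg_join_inl (H1 H2 : sgraph) (x : H1) :
  deg (inl x : join H1 H2) = (#|H2| + deg x)%N.
Proof. by rewrite !deg_sum1 big_sumType /= addnC -[in RHS]sum1_card. Qed.

Lemma deg_join_inr (H1 H2 : sgraph) (y : H2) :
  deg (inr y : join H1 H2) = (#|H1| + deg y)%N.
Proof. by rewrite !deg_sum1 big_sumType /= -[in RHS]sum1_card. Qed.

(** The mean is taken over the second side only, yet the bound is the same for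
vertices of either side: once chi has mean 0 on the second side, the energy is the
sum of two nonnegative parts, one for each side, and each part has the form of
[vertex_energy_bound] with c the order of the opposite side. *)
Lemma join_poincare (R : realType) (H1 H2 : sgraph)
    (H1_gt0 : (0 < #|H1|)%N) (H2_gt0 : (0 < #|H2|)%N)
    (phi : join H1 H2 -> R) (v : join H1 H2) :
  (deg v)%:R * (phi v - #|H2|%:R^-1 * \sum_(y : H2) phi (inr y)) ^+ 2 <=
    2 * energy phi.
Proof.
set s := _ * \sum_y _.
pose chi u := phi u - s.
have -> : energy phi = energy chi.
  congr (_ * _); apply: eq_bigr => x _; apply: eq_bigr => y _.
  by rewrite /chi; ring.
have chi0 : \sum_(y : H2) chi (inr y) = 0.
  rewrite sumrB sumr_const -[s *+ _]mulr_natl mulVKf ?subrr //.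
  by rewrite pnatr_eq0 -lt0n.
rewrite -/(chi v) energy_join (join_cross_energy _ _ _ _ _ chi0).
have e1 := energy_ge0 R _ (fun x => chi (inl x)).
have e2 := energy_ge0 R _ (fun y => chi (inr y)).
have q1 : 0 <= #|H2|%:R * \sum_x chi (inl x) ^+ 2.
  by rewrite mulr_ge0 // sumr_ge0 // => x _; rewrite sqr_ge0.
have q2 : 0 <= #|H1|%:R * \sum_y chi (inr y) ^+ 2.
  by rewrite mulr_ge0 // sumr_ge0 // => x _; rewrite sqr_ge0.
case: v => [x|y].
  have := vertex_energy_bound R H1 #|H2|%:R (fun x => chi (inl x)) x.
  by rewrite ler1n deg_join_inl natrD => /(_ H2_gt0); lra.
have := vertex_energy_bound R H2 #|H1|%:R (fun y => chi (inr y)) y.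
by rewrite ler1n deg_join_inr natrD => /(_ H1_gt0); lra.
Qed.

Lemma kemeny_join_le (R : realType) (H1 H2 : sgraph)
    (H1_gt0 : (0 < #|H1|)%N) (H2_gt0 : (0 < #|H2|)%N) (i : join H1 H2) :
  (kemeny R i <= (2 * (#|H1| + #|H2|))%:R%:E)%E.
Proof.
have deg_gt0 (v : join H1 H2) : (0 < deg v)%N.
  by case: v => v; rewrite ?deg_join_inl ?deg_join_inr ltn_addr.
have degn0 (v : join H1 H2) : (deg v)%:R != 0 :> R.
  by rewrite pnatr_eq0 -lt0n.
pose rho (v : join H1 H2) : R := if v is inr _ then #|H2|%:R^-1 else 0.
have rhoE (phi : join H1 H2 -> R) :
    \sum_v rho v * phi v = #|H2|%:R^-1 * \sum_(y : H2) phi (inr y).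
  rewrite big_sumType /= big1 => [|x _]; last by rewrite mul0r.
  by rewrite add0r mulr_sumr.
have rho1 : \sum_v rho v = 1.
  under eq_bigr => v _ do rewrite -[rho v]mulr1.
  by rewrite rhoE sumr_const mulVf // pnatr_eq0 -lt0n.
have C_ge0 (v : join H1 H2) : 0 <= 2 / (deg v)%:R :> R by rewrite divr_ge0.
have poincare (phi : join H1 H2 -> R) v :
    (phi v - \sum_u rho u * phi u) ^+ 2 <= 2 / (deg v)%:R * energy phi.
  rewrite rhoE mulrAC ler_pdivlMr ?ltr0n // mulrC.
  exact: join_poincare.
apply: le_trans (kemeny_le R _ rho _ deg_gt0 rho1 C_ge0 poincare i) _.
rewrite lee_fin; under eq_bigr => v _ do rewrite mulrC divfK //.
by rewrite sumr_const card_sum -[leLHS]mulr_natr natrM.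
Qed.

Theorem theorem4p1 (R : realType) (H1 H2 : sgraph) (n1 n2 n : nat)
  (hn1 : #|H1| = n1) (hn2 : #|H2| = n2)
  (hn1pos : (1 <= n1)%N) (hn2pos : (1 <= n2)%N) (hn : n = (n1 + n2)%N)
  (i : join H1 H2) :
  (kemeny R i <= ((3 * n)%:R)%:E)%E.
Proof.
subst n n1 n2; apply: le_trans (kemeny_join_le R H1 H2 hn1pos hn2pos i) _.
by rewrite lee_fin ler_nat leq_mul2r orbT.
Qed.
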